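(* Let $X$, $Y$ be real Banach spaces. Assume that $f:X\to Y$ is a $C^1$-mapping, that $\eta:Y\to\mathbb{R}_+=[0,\infty)$ is a $C^1$-functional, and that the following conditions hold: (1) for $x \in Y$: $\eta(x)=0 \Leftrightarrow x=0$, and $\eta'(x)=0\Leftrightarrow x=0$; (2) for any $y\in Y$ the functional $\varphi:X\to\mathbb{R}$ given by $\varphi(x)=\eta(f(x)-y)$ satisfies the Palais-Smale condition; (3) $f'(x)\in \operatorname{Isom}(X,Y)$ for any $x\in X$. Then $f$ is a diffeomorphism.
   Context: $C^1$ means continuously Fréchet differentiable. $f'(x)\in\operatorname{Isom}(X,Y)$ means that the continuous linear operator $f'(x):X\to Y$ is surjective and there is a constant $\alpha_x>0$ such that $\|f'(x)h\|\ge \alpha_x\|h\|$ for all $h\in X$. A Gâteaux differentiable functional $J:E\to\mathbb{R}$ on a Banach space $E$ satisfies the Palais-Smale condition if every sequence $(u_n)$ in $E$ such that $(J(u_n))$ is bounded and $J'(u_n)\to 0$ (in $E^*$) has a (norm-)convergent subsequence. A continuously Fréchet differentiable map $f:X\to Y$ is called a diffeomorphism if it is a bijection and its inverse $f^{-1}:Y\to X$ is continuously Fréchet differentiable as well. *)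

(* Defs.v *)
From HB Require Import structures.
From mathcomp Require Import all_boot all_order all_algebra.
From mathcomp Require Import all_classical all_reals all_analysis.

Set Implicit Arguments.
Unset Strict Implicit.
Unset Printing Implicit Defensive.

Import Order.TTheory GRing.Theory Num.Theory.
Import numFieldNormedType.Exports.

Local Open Scope classical_set_scope.
Local Open Scope ring_scope.

(* Extended-real valued, so that it is [+oo] (rather than a default value of
   [sup]) on unbounded maps; convergence to 0 then really is norm convergence. *)
Definition opnorm (R : realType) (V W : normedModType R) (L : V -> W) : \bar R :=
  ereal_sup [set (`|L h|)%:E | h in [set h : V | `|h| <= 1]].

Definition C1 (R : realType) (V W : normedModType R) (f : V -> W) : Prop :=
  (forall x, differentiable f x) /\
  (forall x, opnorm ('d f z \- 'd f x) @[z --> x] --> 0%E).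

Definition Isom (R : realType) (V W : normedModType R) (L : {linear V -> W}) : Prop :=
  [/\ continuous L,
      (forall y : W, exists x : V, L x = y) &
      exists2 alpha : R, 0 < alpha & forall h : V, alpha * `|h| <= `|L h|].

Definition gateaux_derivative (R : realType) (V : normedModType R)
    (J : V -> R) (x : V) : V -> R :=
  fun h => 'D_h J x.

Definition gateaux_differentiable (R : realType) (V : normedModType R)
    (J : V -> R) (x : V) : Prop :=
  [/\ (forall h, derivable J x h),
      linear (gateaux_derivative J x) &
      continuous (gateaux_derivative J x)].

Definition palais_smale (R : realType) (V : normedModType R) (J : V -> R) : Prop :=
  (forall x, gateaux_differentiable J x) /\
  (forall u : nat -> V,
     bounded_fun (J \o u) ->
     opnorm (gateaux_derivative J (u n)) @[n --> \oo] --> 0%E ->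
     exists2 k : nat -> nat, {homo k : m n / (m < n)%N} &
       cvg ((u \o k) n @[n --> \oo])).

Definition diffeomorphism (R : realType) (V W : normedModType R) (f : V -> W) : Prop :=
  C1 f /\ exists g : W -> V, [/\ cancel f g, cancel g f & C1 g].

(* Main.v *)
(* For fixed y, F x = eta (f x - y) is a nonnegative C^1 functional whose only
   critical points are its zeros, because f'(x) is onto. Ekeland's principle and
   the Palais-Smale condition give a zero, so f is onto, and also show that F is
   bounded away from 0 on closed sets without zeros. Zeros are isolated since
   f'(x) is bounded below; two distinct zeros would be separated by a sphere on
   which F >= a > 0, and the mountain pass theorem would give critical points at
   a positive level. Continuity of the inverse follows from the same bound
   F >= a off a neighbourhood of the zero, and its C^1 character from the linear
   estimates of the inverse function theorem. *)
Require Import Defs.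
From HB Require Import structures.
From mathcomp Require Import all_boot all_order all_algebra.
From mathcomp Require Import all_classical all_reals all_analysis.
From mathcomp Require Import lra.
Import Order.TTheory GRing.Theory Num.Theory.
Import numFieldNormedType.Exports.
Local Open Scope classical_set_scope.
Local Open Scope ring_scope.
Set Implicit Arguments.
Unset Strict Implicit.

(** * An ordering principle for functionals bounded below *)

Lemma le_addinvn (R : realType) (a b : R) :
  (forall n : nat, a <= b + n.+1%:R^-1) -> a <= b.
Proof.
move=> ab; apply/ler_addgt0Pr => e e0.
have [N _ /(_ N (leqnn N)) NP] := near_infty_natSinv_lt (PosNum e0).
by apply: (le_trans (ab N)); rewrite lerD2l ltW.
Qed.

(** Each term of a decreasing sequence is chosen to minimize [F] up to [1 / (n + 1)] among the
    elements below its predecessor. A lower bound [v] of the sequence works: whatever lies below [v]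
    competed in every choice. *)
Lemma brezis_browder (R : realType) (T : Type) (le : T -> T -> Prop)
    (F : T -> R) (m : R) :
  (forall x, le x x) -> (forall x y z, le x y -> le y z -> le x z) ->
  (forall x y, le x y -> F x <= F y) -> (forall x, m <= F x) ->
  (forall u : nat -> T, (forall n, le (u n.+1) (u n)) ->
    exists v, forall n, le v (u n)) ->
  forall a, exists2 v, le v a & forall w, le w v -> F v <= F w.
Proof.
move=> refl trans mono Fm lb a.
(* The pair carries the index, on which the tolerance of each choice depends. *)
have step (p : nat * T) : {q : nat * T | q.1 = p.1.+1 /\ le q.2 p.2 /\
    forall w, le w p.2 -> F q.2 <= F w + p.1.+1%:R^-1}.
  apply: cid; case: p => n x /=.
  have hi : has_inf [set F w | w in [set w | le w x]].
    split; first by exists (F x), x.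
    by exists m => _ [w _ <-].
  have n0 : 0 < n.+1%:R^-1 :> R by rewrite invr_gt0.
  have [_ [y yx <-] Fy] := inf_adherent n0 hi.
  exists (n.+1, y); split=> //; split=> // w wx /=.
  apply: (le_trans (ltW Fy)); rewrite lerD2r.
  by apply: ge_inf; [exact: hi.2|exists w].
have [p [p0 pS]] := dependent_choice step (0%N, a).
have pn n : (p n).1 = n by elim: n => [|n IH]; rewrite ?p0// (pS n).1 IH.
have [v vp] := lb (fun n => (p n).2) (fun n => (pS n).2.1).
exists v; first by have := vp 0%N; rewrite p0.
move=> w wv; apply: le_addinvn => n.
apply: (le_trans (mono _ _ (vp n.+1))).
have := (pS n).2.2 w; rewrite pn; apply.
exact: trans wv (vp n).
Qed.

(** * Operator norm and strict differentiability *)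

Lemma nbhs_distP (R : realType) (V : normedModType R) (x : V) (P : set V) :
  nbhs x P <-> exists2 d : R, 0 < d & forall y, `|y - x| < d -> P y.
Proof.
split.
  move=> /nbhs_normP[d d0 dP]; exists d => // y yx.
  by apply: dP; rewrite /ball_/= distrC.
move=> [d d0 dP]; apply/nbhs_normP; exists d => // y.
by rewrite /ball_/= distrC => yx; exact: dP.
Qed.

Lemma opnorm_leP (R : realType) (V W : normedModType R) (L : V -> W) (e : R) :
  0 <= e -> (forall k h, L (k *: h) = k *: L h) ->
  (opnorm L <= e%:E)%E <-> forall h, `|L h| <= e * `|h|.
Proof.
move=> e0 LZ; split=> [Le h|Le]; last first.
  apply: ge_ereal_sup => _ [h /= h1 <-]; rewrite lee_fin.
  by apply: (le_trans (Le h)); rewrite ler_piMr.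
have [->|hn0] := eqVneq h 0.
  by rewrite -(scale0r (0 : V)) LZ !scale0r !normr0 mulr0.
have h0 : 0 < `|h| by rewrite normr_gt0.
have : ((`|L (`|h|^-1 *: h)|)%:E <= e%:E)%E.
  apply: le_trans Le; apply: ereal_sup_ubound; exists (`|h|^-1 *: h) => //=.
  by rewrite normrZ normfV normr_id mulVf ?gt_eqF.
by rewrite LZ normrZ normfV normr_id lee_fin mulrC ler_pdivrMr.
Qed.

Lemma opnorm_ge0 (R : realType) (V W : normedModType R) (L : V -> W) :
  (0 <= opnorm L)%E.
Proof.
apply: (@le_trans _ _ (`|L 0|)%:E); first by rewrite lee_fin.
by apply: ereal_sup_ubound; exists 0 => //=; rewrite normr0.
Qed.

(** Asking only for homogeneity lets this apply both to differences of differentials and to Gâteaux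
    derivatives, which are bare functions. *)
Lemma cvg_opnorm0P (R : realType) (T : Type) (F : set_system T) {FF : Filter F}
    (V W : normedModType R) (L : T -> V -> W) :
  (forall t k h, L t (k *: h) = k *: L t h) ->
  opnorm (L t) @[t --> F] --> 0%E <->
  forall e : R, 0 < e -> \forall t \near F, forall h, `|L t h| <= e * `|h|.
Proof.
move=> LZ; split=> [L0 e e0|L0].
  have := L0 _ (@open_ereal_lt' R 0%E e%:E _); rewrite lte_fin => /(_ e0).
  move=> H; apply: (@filterS T F FF _ _ _ H) => t /= Lt.
  exact/(opnorm_leP (ltW e0) (LZ t))/ltW.
have Le e : 0 < e -> \forall t \near F, (0 <= opnorm (L t) <= e%:E)%E.
  move=> e0; apply: filterS (L0 e e0) => t Lt.
  by rewrite opnorm_ge0/=; apply/(opnorm_leP (ltW e0) (LZ t)).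
apply/fine_cvgP; split.
  apply: filterS (Le 1 ltr01) => t /andP[t0 t1].
  by rewrite ge0_fin_numE// (le_lt_trans t1)// ltry.
apply/cvgrPdist_le => e e0; apply: filterS (Le e e0) => t /andP[t0 te] /=.
rewrite sub0r normrN ger0_norm ?fine_ge0// -lee_fin fineK//.
by rewrite ge0_fin_numE// (le_lt_trans te)// ltry.
Qed.

(** Strict differentiability: both points vary, unlike in the Fréchet condition. [L] is a bare
    function, so that composites and families of real functionals fit. *)
Definition strict_diff (R : realType) (V W : normedModType R) (g : V -> W)
    (x : V) (L : V -> W) :=
  forall e : R, 0 < e -> exists2 d : R, 0 < d & forall a b : V,
    `|a - x| < d -> `|b - x| < d -> `|g b - g a - L (b - a)| <= e * `|b - a|.

Lemma differentiable_distP (R : realType) (V W : normedModType R) (g : V -> W)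
    (x : V) (L : {linear V -> W}) :
  (g \o shift x = cst (g x) + L +o_ 0 id) <->
  forall e : R, 0 < e -> exists2 d : R, 0 < d & forall z : V,
    `|z - x| < d -> `|g z - g x - L (z - x)| <= e * `|z - x|.
Proof.
split=> [H e e0|H].
  have /eqaddoP /(_ e e0) /nbhs_distP[d d0 dP] := H; exists d => // z zx.
  have := dP (z - x); rewrite subr0 => /(_ zx).
  by rewrite !fctE/= subrK opprD addrA.
apply/eqaddoP => e e0; have [d d0 dP] := H e e0.
apply/nbhs_distP; exists d => // h; rewrite subr0 => hd.
have := dP (h + x); rewrite addrK => /(_ hd).
by rewrite !fctE/= opprD addrA.
Qed.

(** Supremum argument on the set of [t] with [|F t - F 0| <= M * t]. A member just below the
    supremum [t0] and a point just above are both compared with [t0], so the bound passes beyond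
    [t0] unless [t0 = 1]. *)
Lemma mean_value_le (R : realType) (W : normedModType R) (F : R -> W) (M : R) :
  (forall t, 0 <= t <= 1 -> exists2 d, 0 < d & forall s, `|s - t| < d ->
     `|F s - F t| <= M * `|s - t|) ->
  `|F 1 - F 0| <= M.
Proof.
move=> FM.
pose S := [set t : R | 0 <= t <= 1 /\ `|F t - F 0| <= M * t].
have S0 : S 0 by split; rewrite ?lexx ?ler01// subrr normr0 mulr0.
have hS : has_sup S by split; [exists 0|exists 1 => t [/andP[]]].
have [t0 ubS [adS t01]] : exists2 t0, forall t, S t -> t <= t0 &
    (forall d, 0 < d -> exists2 s, S s & t0 - d < s) /\ t0 <= 1.
  exists (sup S); first by move=> t; apply: ub_le_sup; exact: hS.2.
  split; first by move=> d d0; exact: sup_adherent.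
  by apply: ge_sup => [|t [/andP[]]//]; exists 0.
have t00 : 0 <= t0 by exact: ubS.
have t0I : 0 <= t0 <= 1 by rewrite t00.
have [d d0 dP] := FM t0 t0I.
have [s Ss st0] := adS d d0.
have [/andP[s0 s1] Fs] := Ss.
have sle : s <= t0 by exact: ubS.
have step t : t0 <= t -> t < t0 + d -> `|F t - F 0| <= M * t.
  move=> tt0 td.
  have -> : F t - F 0 = (F t - F t0) - (F s - F t0) + (F s - F 0).
    by rewrite opprB !subrKA.
  apply: (le_trans (ler_normD _ _)).
  apply: (le_trans (lerD (ler_normB _ _) Fs)).
  have /dP H1 : `|t - t0| < d by rewrite ger0_norm ?subr_ge0//; lra.
  have /dP H2 : `|s - t0| < d by rewrite ler0_norm ?subr_le0//; lra.
  move: H1 H2; rewrite ger0_norm ?subr_ge0// ler0_norm ?subr_le0// => H1 H2.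
  apply: (le_trans (lerD (lerD H1 H2) (lexx _))); lra.
have [t01'|t01'] := ltP t0 1; last first.
  by have := step 1 t01; rewrite mulr1; apply; lra.
pose t := Num.min 1 (t0 + d / 2).
have tt0 : t0 < t by rewrite lt_min t01'/=; lra.
suff : t <= t0 by lra.
apply: ubS; split; first by rewrite ge_min lexx/= le_min ler01 andbT; apply/andP; split=> //; lra.
apply: step; first exact: ltW.
by rewrite gt_min; apply/orP; right; lra.
Qed.

Lemma diff_dist (R : realType) (V W : normedModType R) (g : V -> W) (x : V) :
  differentiable g x ->
  forall e : R, 0 < e -> exists2 d : R, 0 < d & forall z : V,
    `|z - x| < d -> `|g z - g x - 'd g x (z - x)| <= e * `|z - x|.
Proof. by move=> /diff_locallyP[_ /differentiable_distP]. Qed.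

Lemma C1_dist (R : realType) (V W : normedModType R) (g : V -> W) (x : V) :
  C1 g -> forall e : R, 0 < e -> exists2 d : R, 0 < d & forall z : V,
    `|z - x| < d -> forall h, `|'d g z h - 'd g x h| <= e * `|h|.
Proof.
move=> [_ /(_ x) gC] e e0; apply/nbhs_distP.
apply: (cvg_opnorm0P _).1 gC e e0 => z k h /=.
by rewrite !linearZ; exact/esym/scalerDr.
Qed.

(** The mean value inequality is applied to [g] minus its linear part at [x] along the segment from
    [a] to [b], which stays in the ball around [x]. One [e / 2] pays for differentiability at [p t],
    the other for the variation of ['d g] between [x] and [p t]. *)
Lemma C1_strict_diff (R : realType) (V W : normedModType R) (g : V -> W)
  (x : V) : C1 g -> strict_diff g x ('d g x).
Proof.
move=> gC e e0; have e20 : 0 < e / 2 by rewrite divr_gt0.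
have [d d0 dP] := C1_dist x gC e20; exists d => // a b ax bx.
pose p (t : R) := a + t *: (b - a).
have px t : 0 <= t <= 1 -> `|p t - x| < d.
  move=> /andP[t0 t1].
  have -> : p t - x = (1 - t) *: (a - x) + t *: (b - x).
    rewrite scalerBl scale1r -[RHS]addrA [- _ + _]addrC -scalerBr opprB subrKA.
    by rewrite /p addrAC.
  apply: (le_lt_trans (ler_normD _ _)); rewrite !normrZ ger0_norm ?subr_ge0//.
  rewrite [`|t|]ger0_norm//.
  pose m := Num.max `|a - x| `|b - x|.
  have md : m < d by rewrite /m gt_max ax.
  apply: le_lt_trans md.
  have -> : m = (1 - t) * m + t * m by rewrite -mulrDl subrK mul1r.
  by apply: lerD; apply: ler_wpM2l; rewrite ?subr_ge0// le_max lexx ?orbT.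
pose F (t : R) := g (p t) - t *: 'd g x (b - a).
have -> : g b - g a - 'd g x (b - a) = F 1 - F 0.
  rewrite /F /p !scale1r !scale0r addr0 subr0 [a + _]addrC subrK.
  by rewrite addrAC.
apply: mean_value_le => t t01.
have [ab0|abn0] := eqVneq (b - a) 0.
  exists 1 => // s _; have -> : F s = F t.
    by rewrite /F /p ab0 (linear0 ('d g x)) !scaler0.
  by rewrite subrr ab0 !normr0 mulr0 mul0r.
have abp : 0 < `|b - a| by rewrite normr_gt0.
have [r r0 rP] := diff_dist (gC.1 (p t)) e20.
exists (r / `|b - a|); first by rewrite divr_gt0.
move=> s st.
have pst : p s - p t = (s - t) *: (b - a).
  by rewrite /p opprD addrACA subrr add0r -scalerBl.
have : `|p s - p t| < r by rewrite pst normrZ -ltr_pdivlMr.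
move=> /rP; rewrite pst linearZ normrZ => H1.
have H2 := dP (p t) (px t t01) (b - a).
have -> : F s - F t = (g (p s) - g (p t) - (s - t) *: 'd g (p t) (b - a)) +
    (s - t) *: ('d g (p t) (b - a) - 'd g x (b - a)).
  by rewrite scalerBr addrA subrK /F scalerBl 2!opprD addrACA.
apply: (le_trans (ler_normD _ _)); rewrite normrZ.
apply: (le_trans (lerD H1 (ler_wpM2l (normr_ge0 _) H2))).
by rewrite [leLHS](_ : _ = e * `|b - a| * `|s - t|)//; lra.
Qed.

Lemma linear_bound (R : realType) (V W : normedModType R) (L : {linear V -> W}) :
  continuous L -> exists2 C : R, 0 < C & forall h, `|L h| <= C * `|h|.
Proof.
move=> /linear_bounded_continuous/linear_boundedP[M [_ MP]].
exists (`|M| + 1); first by rewrite ltr_wpDl.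
by apply: MP; rewrite (le_lt_trans (ler_norm M))// ltrDl.
Qed.

(** * Telescoping sequences and Ekeland's principle *)

(** The increments sum to at most the total decrease of [c], so [u] is Cauchy. The error bound
    depends on [c] alone, which makes it uniform when [u] depends on a parameter. *)
Lemma cvg_of_telescope (R : realType) (E : completeNormedModType R)
    (u : nat -> E) (c : nat -> R) (m : R) :
  (forall n, `|u n.+1 - u n| <= c n - c n.+1) -> (forall n, m <= c n) ->
  cvg (c n @[n --> \oo]) /\
  exists2 l, u n @[n --> \oo] --> l &
    forall n, `|l - u n| <= c n - limn c.
Proof.
move=> uc cm.
have chain n k : `|u (n + k)%N - u n| <= c n - c (n + k)%N.
  elim: k => [|k IH]; first by rewrite addn0 !subrr normr0.
  rewrite addnS -(subrKA (u (n + k)%N)) -[leRHS](subrKA (c (n + k)%N)).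
  by apply: (le_trans (ler_normD _ _)); rewrite addrC lerD.
have cdec : {homo c : n p / (n <= p)%N >-> p <= n}.
  move=> n p /subnKC <-; rewrite -subr_ge0.
  exact: le_trans (normr_ge0 _) (chain _ _).
have ccvg : cvg (c n @[n --> \oo]).
  by apply: nonincreasing_is_cvgn => //; exists m => _ [n _ <-].
have cge n : limn c <= c n by exact: nonincreasing_cvgn_ge.
split=> //.
have small e : 0 < e -> exists n, c n < limn c + e.
  move=> e0; have /cvgrPdist_lt /(_ e e0) [N _ /(_ N (leqnn N)) /=] := ccvg.
  rewrite distrC ger0_norm ?subr_ge0// => cN; exists N.
  by rewrite -ltrBlDl.
have ucvg : cvg (u n @[n --> \oo]).
  apply: cauchy_cvg; apply: cauchy_exP => e e0.
  have [N cN] := small e e0; exists (u N); exists N => // n /= Nn.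
  rewrite -ball_normE /ball_/= distrC -(subnKC Nn).
  apply: (le_lt_trans (chain _ _)); rewrite (subnKC Nn).
  by have := cge n; lra.
exists (limn u) => // n; apply/ler_addgt0Pr => e e0.
have /cvgrPdist_lt /(_ e e0) [N _ NP] := ucvg.
have /NP/= : (N <= n + N)%N by exact: leq_addl.
move=> H; rewrite -(subrKA (u (n + N)%N)).
apply: (le_trans (ler_normD _ _)); rewrite addrC lerD//; last exact: ltW.
by apply: (le_trans (chain _ _)); rewrite lerD2l lerN2.
Qed.

(** Ordering principle for [le x y := e * |x - y| <= F y - F x]. Decreasing sequences telescope,
    hence converge by completeness to a lower bound. *)
Lemma ekeland (R : realType) (E : completeNormedModType R) (F : E -> R)
    (m e : R) : 0 < e -> continuous F -> (forall x, m <= F x) ->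
  forall a, exists2 v, F v + e * `|v - a| <= F a &
    forall w, F v <= F w + e * `|w - v|.
Proof.
move=> e0 Fc Fm a.
pose le x y := e * `|x - y| <= F y - F x.
have [] := @brezis_browder R E le F m _ _ _ Fm _ a.
- by move=> x; rewrite /le !subrr normr0 mulr0.
- move=> x y z; rewrite /le => xy yz.
  have : e * `|x - z| <= e * `|x - y| + e * `|y - z|.
    by rewrite -mulrDr ler_pM2l// ler_distD.
  by lra.
- move=> x y; rewrite /le => xy; rewrite -subr_ge0.
  by apply: le_trans xy; rewrite mulr_ge0// ltW.
- move=> u ule.
  have [n|n|cc [l ul lu]] := @cvg_of_telescope R E u (fun n => F (u n) / e) (m / e).
  + by rewrite -mulrBl ler_pdivlMr// mulrC; exact: ule.
  + by rewrite ler_pM2r ?invr_gt0.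
  exists l => n; rewrite /le.
  suff -> : F l = limn (fun n => F (u n) / e) * e.
    by rewrite mulrC -ler_pdivlMr// mulrBl mulfK ?gt_eqF.
  have Ful : F (u n) @[n --> \oo] --> F l by apply: cvg_comp ul _; exact: Fc.
  have /cvg_lim-> // : F (u n) / e @[n --> \oo] --> F l / e.
    by apply: cvgM => //; exact: cvg_cst.
  by rewrite divfK ?gt_eqF.
move=> v va vmin; exists v; first by move: va; rewrite /le; lra.
move=> w; rewrite leNgt; apply/negP => wv.
have : le w v by rewrite /le; lra.
move=> /vmin; have : 0 <= e * `|w - v| by rewrite mulr_ge0// ltW.
by lra.
Qed.

(** * Consequences of strict differentiability *)

Lemma strict_diff_continuous (R : realType) (V W : normedModType R)
    (g : V -> W) (x : V) (L : V -> W) (C : R) :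
  (forall h, `|L h| <= C * `|h|) -> strict_diff g x L -> {for x, continuous g}.
Proof.
move=> LC /(_ 1 ltr01)[d d0 dP]; apply/cvgrPdist_lt => e e0.
have C0 : 0 < `|C| + 1 + 1 by rewrite !ltr_wpDl// addr_ge0.
apply/nbhs_distP; exists (Num.min d (e / (`|C| + 1 + 1))).
  by rewrite lt_min d0 divr_gt0.
move=> z; rewrite lt_min => /andP[zd ze].
have /(_ z) H := dP x; rewrite subrr normr0 in H.
have {}H := H d0 zd; rewrite distrC -[g z - g x](subrK (L (z - x))).
apply: (le_lt_trans (ler_normD _ _)).
apply: (le_lt_trans (lerD H (LC _))).
have : (1 * `|z - x| + C * `|z - x|) <= (`|C| + 1 + 1) * `|z - x|.
  rewrite -mulrDl ler_wpM2r//; have := ler_norm C; lra.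
move=> /le_lt_trans; apply.
by rewrite mulrC -ltr_pdivlMr.
Qed.

Lemma small_scale (R : realType) (V : normedModType R) (h : V) (d : R) :
  0 < d -> exists2 t : R, 0 < t & `|t *: h| < d.
Proof.
move=> d0; have h1 : 0 < `|h| + 1 by rewrite ltr_wpDl.
exists (d / (`|h| + 1)); first by rewrite divr_gt0.
rewrite normrZ ger0_norm; last by rewrite divr_ge0// ltW.
rewrite mulrAC ltr_pdivrMr// ltr_pM2l//; lra.
Qed.

(** Strict differentiability everywhere forces the derivative to be continuous: on the pair [z],
    [z + t *: h] the estimates at [x] and at [z] both hold, and dividing by [t] compares [L x h]
    with [L z h]. *)
Lemma strict_diff_near (R : realType) (V W : normedModType R) (g : V -> W)
    (L : V -> V -> W) (x : V) :
  (forall z k h, L z (k *: h) = k *: L z h) ->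
  (forall z, strict_diff g z (L z)) ->
  forall e : R, 0 < e -> exists2 d : R, 0 < d & forall z : V,
    `|z - x| < d -> forall h, `|L z h - L x h| <= e * `|h|.
Proof.
move=> LZ gL e e0; have [d d0 dP] := gL x e e0; exists d => // z zx h.
apply/ler_addgt0Pr => r r0.
(* Adding 1 to the norm of [h] covers [h = 0] without a case distinction. *)
have r10 : 0 < r / (`|h| + 1) by rewrite divr_gt0// ltr_wpDl.
have [d' d'0 d'P] := gL z _ r10.
have dd0 : 0 < Num.min d' (d - `|z - x|) by rewrite lt_min d'0 subr_gt0.
have [t t0] := small_scale h dd0; rewrite lt_min ltrBrDr => /andP[td' td].
have H1 := dP z (z + t *: h) zx.
have {}H1 : `|g (z + t *: h) - g z - t *: L x h| <= e * (t * `|h|).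
  have := H1; rewrite [z + _]addrC -!addrA; rewrite !addrA addrK LZ normrZ.
  rewrite gtr0_norm//; apply; rewrite -addrA.
  exact: le_lt_trans (ler_normD _ _) td.
have := d'P z (z + t *: h); rewrite subrr normr0 => /(_ d'0).
rewrite [z + _]addrC addrK LZ [t *: h + z]addrC => /(_ td').
rewrite normrZ gtr0_norm// => H2.
have : `|t *: (L z h - L x h)| <= r / (`|h| + 1) * (t * `|h|) + e * (t * `|h|).
  rewrite scalerBr -(subrKA (g (z + t *: h) - g z)); apply: (le_trans (ler_normD _ _)).
  by rewrite [`|t *: _ - _|]distrC lerD.
have : r / (`|h| + 1) * (t * `|h|) <= t * r.
  rewrite mulrCA ler_pM2l// mulrAC ler_pdivrMr ?ltr_wpDl// ler_pM2l//; lra.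
by rewrite normrZ gtr0_norm// => H3 H4; rewrite -(ler_pM2l t0); lra.
Qed.

(** At an Ekeland point, comparison with [v + t *: h] for a small positive [t] bounds [L h] from
    below; the vector [- h] gives the other side. *)
Lemma slope_le (R : realType) (V : normedModType R) (F : V -> R) (v : V)
    (L : V -> R) (e : R) :
  (forall k h, L (k *: h) = k * L h) -> strict_diff F v L ->
  (forall w, F v <= F w + e * `|w - v|) -> forall h, `|L h| <= e * `|h|.
Proof.
move=> LZ FL Fv.
suff H h : - (e * `|h|) <= L h.
  move=> h; rewrite ler_norml H/=; have := H (- h).
  by rewrite normrN -(scaleN1r h) LZ mulN1r lerN2.
apply/ler_addgt0Pr => r r0.
have h1 : 0 < `|h| + 1 by rewrite ltr_wpDl.
have r10 : 0 < r / (`|h| + 1) by rewrite divr_gt0.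
have [d d0 dP] := FL _ r10.
have [t t0 td] := small_scale h d0.
have := dP v (v + t *: h); rewrite subrr normr0 addrC addKr.
move=> /(_ d0 td); rewrite LZ normrZ (gtr0_norm t0).
move=> /ler_normlW H; have := Fv (v + t *: h); rewrite [v + _]addrC addrK [_ + v]addrC.
rewrite normrZ gtr0_norm// => H2.
have : r / (`|h| + 1) * (t * `|h|) <= t * r.
  rewrite mulrCA ler_pM2l// mulrAC ler_pdivrMr// ler_pM2l//; lra.
by move=> H3; rewrite -(ler_pM2l t0); lra.
Qed.

(** * Zeros of Palais-Smale functionals *)

(** Form suited to nonnegative functionals, where an upper bound is a bound. The rate [1 / (n + 1)]
    is the one produced by the constructions below, and [n <= k n] expresses that the selected
    indices go to infinity. *)
Definition palais_smale_seq (R : realType) (V : normedModType R) (F : V -> R)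
    (D : V -> V -> R) :=
  forall (u : nat -> V) (B : R), (forall n, F (u n) <= B) ->
    (forall n h, `|D (u n) h| <= n.+1%:R^-1 * `|h|) ->
    exists (k : nat -> nat) (l : V),
      (forall n, (n <= k n)%N) /\ u (k n) @[n --> \oo] --> l.

(** Interface between the variational arguments and the functionals [x |-> eta (f x - y)], with [D]
    in the role of the derivative. *)
Record zero_critical (R : realType) (V : normedModType R) (F : V -> R)
    (D : V -> V -> R) : Prop := {
  zc_ge0 : forall x, 0 <= F x ;
  zc_scale : forall x k h, D x (k *: h) = k * D x h ;
  zc_bound : forall x, exists C, forall h, `|D x h| <= C * `|h| ;
  zc_diff : forall x, strict_diff F x (D x) ;
  zc_ps : palais_smale_seq F D ;
  zc_zero : forall x, (forall h, D x h = 0) -> F x = 0 }.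

Lemma zc_continuous (R : realType) (V : normedModType R) (F : V -> R) D :
  zero_critical F D -> continuous F.
Proof.
move=> FD x; have [C HC] := zc_bound FD x.
exact: strict_diff_continuous HC (zc_diff FD x).
Qed.

Lemma cvg_dist_near (R : realType) (V : normedModType R) (u : nat -> V) (l : V) :
  u n @[n --> \oo] --> l -> forall e : R, 0 < e ->
  exists N, forall n, (N <= n)%N -> `|u n - l| < e.
Proof.
move=> ul e e0; have /cvgrPdist_lt/(_ e e0)[N _ NP] := ul.
by exists N => n Nn; rewrite distrC; exact: NP.
Qed.

Lemma invSn_lt (R : realType) (e : R) : 0 < e -> exists N : nat, forall n,
  (N <= n)%N -> n.+1%:R^-1 < e.
Proof.
move=> e0; have [N _ NP] := near_infty_natSinv_lt (PosNum e0).
by exists N => n; exact: NP.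
Qed.

(** The limit of the subsequence is critical because [D] is continuous, hence it is a zero. The
    conclusion retains it as a cluster point of [u]. *)
Lemma ps_zero (R : realType) (V : normedModType R) (F : V -> R) D :
  zero_critical F D -> forall (u : nat -> V) (B : R), (forall n, F (u n) <= B) ->
    (forall n h, `|D (u n) h| <= n.+1%:R^-1 * `|h|) ->
    exists l, F l = 0 /\ forall (e : R) (N : nat), 0 < e ->
      exists2 n, (N <= n)%N & `|u n - l| < e.
Proof.
move=> FD u B uB uD; have [k [l [kn kl]]] := zc_ps FD uB uD.
have sub (e : R) (N : nat) : 0 < e -> exists2 n, (N <= n)%N & `|u n - l| < e.
  move=> e0; have [M MP] := cvg_dist_near kl e0.
  exists (k (maxn M N)); last by apply: MP; exact: leq_maxl.
  exact: leq_trans (leq_maxr _ _) (kn _).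
exists l; split=> //; apply: (zc_zero FD) => h; apply/eqP.
rewrite -normr_le0; apply/ler_addgt0Pr => e e0; rewrite add0r.
have h1 : 0 < `|h| + 1 by rewrite ltr_wpDl.
have r0 : 0 < e / 2 / (`|h| + 1) by rewrite !divr_gt0.
have [d d0 dP] := strict_diff_near l (zc_scale FD) (zc_diff FD) r0.
have [N NP] := invSn_lt r0.
have [n Nn nd] := sub d N d0.
have re : e / 2 / (`|h| + 1) * `|h| <= e / 2.
  by rewrite mulrAC ler_pdivrMr// ler_pM2l ?divr_gt0//; lra.
have H1 := le_trans (dP _ nd h) re.
have H2 : `|D (u n) h| <= e / 2.
  apply: (le_trans (uD n h)); apply: le_trans re.
  by rewrite ler_wpM2r// ltW// NP.
rewrite -(subrK (D (u n) h) (D l h)); apply: (le_trans (ler_normD _ _)).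
by rewrite distrC (splitr e) lerD.
Qed.

(** Otherwise some [z n] in [A] satisfies [F (z n) < e n * e n]. Ekeland's principle with slope
    [e n] then moves [z n] by at most [e n], and the new points form a Palais-Smale sequence. Its
    cluster point is a zero that lies in the closed set [A]. *)
Lemma away_from_zeros (R : realType) (V : completeNormedModType R) (F : V -> R)
    D (A : set V) : zero_critical F D -> closed A -> (forall x, A x -> F x != 0) ->
  exists2 a : R, 0 < a & forall x, A x -> a <= F x.
Proof.
move=> FD Ac AF; apply: contrapT => H.
pose e n : R := n.+1%:R^-1.
have e0 n : 0 < e n by rewrite invr_gt0.
have z n : {z | A z /\ F z < e n * e n}.
  apply: cid; apply: contrapT => Hn; apply: H.
  exists (e n * e n); first by rewrite mulr_gt0.
  move=> x Ax; rewrite leNgt; apply/negP => Fx; apply: Hn.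
  by exists x.
have w n : {w | F w + e n * `|w - sval (z n)| <= F (sval (z n)) /\
    forall x, F w <= F x + e n * `|x - w|}.
  apply: cid; have [w w1 w2] := ekeland (e0 n) (zc_continuous FD) (zc_ge0 FD) (sval (z n)).
  by exists w.
pose u n := sval (w n).
have uP n : F (u n) + e n * `|u n - sval (z n)| <= F (sval (z n)) :=
  (svalP (w n)).1.
have uz n : `|u n - sval (z n)| <= e n.
  rewrite -(ler_pM2l (e0 n)); have := uP n; have := (svalP (z n)).2.
  have := zc_ge0 FD (u n); lra.
have e1 n : e n <= 1 by rewrite /e invf_le1 ?ltr0n// ler1n.
have uB n : F (u n) <= 1.
  have : e n * e n <= 1 by rewrite mulr_ile1// ltW.
  have : 0 <= e n * `|u n - sval (z n)| by rewrite mulr_ge0// ltW.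
  have := uP n; have := (svalP (z n)).2; lra.
have [l [Fl lu]] := ps_zero FD uB (fun n =>
  slope_le (zc_scale FD (u n)) (zc_diff FD (u n)) (svalP (w n)).2).
have [Al|/=nAl] := pselect (A l); first by have := AF l Al; rewrite Fl eqxx.
have /nbhs_distP[d d0 dA] : nbhs l (~` A).
  by apply: open_nbhs_nbhs; split=> //; exact: closed_openC.
have d20 : 0 < d / 2 by rewrite divr_gt0.
have [N NP] := invSn_lt d20.
have [n Nn nd] := lu _ N d20.
apply: (dA (sval (z n))); last exact: (svalP (z n)).1.
rewrite -(subrKA (u n)); apply: (le_lt_trans (ler_normD _ _)).
rewrite distrC; have := uz n; have := NP n Nn; rewrite -/(e n); lra.
Qed.

(** Ekeland points for the slopes [1 / (n + 1)], all started at 0, form a Palais-Smale sequence. *)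
Lemma exists_zero (R : realType) (V : completeNormedModType R) (F : V -> R) D :
  zero_critical F D -> exists x, F x = 0.
Proof.
move=> FD; apply: contrapT => H.



pose e n : R := n.+1%:R^-1.
have e0 n : 0 < e n by rewrite invr_gt0.
have w n : {w | F w + e n * `|w - 0| <= F 0 /\
    forall x, F w <= F x + e n * `|x - w|}.
  apply: cid; have [w w1 w2] := ekeland (e0 n) (zc_continuous FD) (zc_ge0 FD) 0.
  by exists w.
have wB n : F (sval (w n)) <= F 0.
  by apply: le_trans (svalP (w n)).1; rewrite lerDl mulr_ge0// ltW.
have [l [Fl _]] := ps_zero FD wB (fun n =>
  slope_le (zc_scale FD _) (zc_diff FD _) (svalP (w n)).2).
by apply: H; exists l.
Qed.

(** * Descending deformation of a path *)

Lemma continuous_distP (R : realType) (V W : normedModType R) (g : V -> W)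
    (x : V) : {for x, continuous g} <-> forall e : R, 0 < e ->
  exists2 d : R, 0 < d & forall y, `|y - x| < d -> `|g y - g x| < e.
Proof.
split=> [/cvgrPdist_lt gx e e0|H].
  have /nbhs_distP[d d0 dP] := gx e e0.
  by exists d => // y /dP; rewrite /= distrC.
apply/cvgrPdist_lt => e e0; have [d d0 dP] := H e e0.
by apply/nbhs_distP; exists d => // y /dP; rewrite /= distrC.
Qed.

(** Retraction onto [0, 1]. It lets paths be functions on the whole line, constant outside [0, 1],
    with ordinary continuity. *)
Definition clamp (R : realType) (t : R) : R := Num.max 0 (Num.min 1 t).

Lemma clamp_itv (R : realType) (t : R) : 0 <= clamp t <= 1.
Proof. by rewrite /clamp le_max lexx/= ge_max ler01 ge_min lexx. Qed.

Lemma clamp0 (R : realType) (t : R) : t <= 0 -> clamp t = 0.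
Proof.
by move=> t0; rewrite /clamp min_r ?(le_trans t0 ler01)// max_l.
Qed.

Lemma clamp1 (R : realType) (t : R) : 1 <= t -> clamp t = 1.
Proof. by move=> t1; rewrite /clamp min_l// max_r. Qed.

Lemma clamp_continuous (R : realType) : continuous (@clamp R).
Proof.
move=> t; apply: continuous_max; first exact: cst_continuous.
by apply: continuous_min; first exact: cst_continuous.
Qed.

Section path_descent.
Context (R : realType) (V : normedModType R) (F : V -> R) (D : V -> V -> R).
Hypothesis Dscale : forall x k h, D x (k *: h) = k * D x h.
Hypothesis Fdiff : forall x, strict_diff F x (D x).
Hypothesis Fc : continuous F.
Context (g : R -> V) (M a m e : R).
Hypothesis e0 : 0 < e.
Hypothesis gc : continuous g.
Hypothesis g0 : forall t, t <= 0 -> g t = g 0.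
Hypothesis g1 : forall t, 1 <= t -> g t = g 1.
Hypothesis gM : forall t, F (g t) <= M.
Hypothesis ma : m < a.
Hypothesis aM : a <= M.
Hypothesis Fg0 : F (g 0) < m.
Hypothesis Fg1 : F (g 1) < m.
Hypothesis steep : forall x, m <= F x -> F x <= M ->
  exists2 v, `|v| <= 1 & D x v < - e.

(** The decrease is measured from the ceiling [M] and not from [F (g s)], so points that are already
    low may stay put. *)
Definition descends (h : R -> V) (r : R) (P : R -> Prop) :=
  forall s t, P s -> 0 <= t <= r -> F (g s + t *: h s) <= M - e * t.

(* The start [x] ranges over points already moved down by [e * t1], so that
   successive displacements can be composed. *)
Definition local_descent (t0 : R) (v : V) (r : R) :=
  forall s x t1 t2, `|s - t0| < r -> `|x - g s| < r -> 0 <= t1 -> 0 <= t2 ->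
    t1 + t2 < r -> F x <= M - e * t1 -> F (x + t2 *: v) <= M - e * (t1 + t2).

(** The zero vector suffices: nearby values stay below [m], and the required level stays above [m]
    for times less than [(a - m) / e]. *)
Lemma local_descent_low t0 : F (g t0) < m ->
  exists2 r, 0 < r & local_descent t0 0 r.
Proof.
move=> low.
have mF : 0 < m - F (g t0) by rewrite subr_gt0.
have [d d0 dP] := (continuous_distP F (g t0)).1 (Fc (x := g t0)) _ mF.
have d20 : 0 < d / 2 by rewrite divr_gt0.
have [r r0 rP] := (continuous_distP g t0).1 (gc (x := t0)) _ d20.
have q0 : 0 < (a - m) / e by rewrite divr_gt0// subr_gt0.
exists (Num.min r (Num.min (d / 2) ((a - m) / e))).
  by rewrite !lt_min r0 d20.
move=> s x t1 t2; rewrite !lt_min => /andP[sr _] /and3P[_ xd _] t10 t20.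
move=> /and3P[_ _]; rewrite ltr_pdivlMr// => tq _.
rewrite scaler0 addr0.
have /dP Fx : `|x - g t0| < d.
  rewrite -(subrKA (g s)); apply: (le_lt_trans (ler_normD _ _)).
  have := rP s sr; lra.
have {}Fx := ltr_normlW Fx; move: aM; rewrite mulrC in tq; lra.
Qed.

(** The slack [- e - D (g t0) v] serves as the tolerance in strict differentiability, so rate [e]
    persists near [g t0]. The thirds of [d] bound the distances from [g t0] to [g s], to [x], and to
    the endpoint. *)
Lemma local_descent_high t0 : m <= F (g t0) ->
  exists v r, [/\ `|v| <= 1, 0 < r & local_descent t0 v r].
Proof.
move=> high; have [v v1 Dv] := steep high (gM t0).
have q0 : 0 < - e - D (g t0) v by lra.
have [d d0 dP] := Fdiff (g t0) q0.
have d30 : 0 < d / 3 by rewrite divr_gt0.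
have [r r0 rP] := (continuous_distP g t0).1 (gc (x := t0)) _ d30.
exists v, (Num.min r (d / 3)); split=> //; first by rewrite lt_min r0.
move=> s x t1 t2; rewrite !lt_min => /andP[sr _] /andP[_ xd] t10 t20.
move=> /andP[_ td] Fx.
have xg : `|x - g t0| < d / 3 + d / 3.
  rewrite -(subrKA (g s)); apply: (le_lt_trans (ler_normD _ _)).
  by rewrite ltrD//; exact: rP.
have tv : `|t2 *: v| <= t2 by rewrite normrZ ger0_norm// ler_piMr.
have := dP x (x + t2 *: v); rewrite [x + _ - x]addrAC subrr add0r Dscale.
move=> /(_ _ _)/ler_normlW H.
have {}H : F (x + t2 *: v) - F x - t2 * D (g t0) v
    <= (- e - D (g t0) v) * t2.
  apply: (le_trans (H _ _)); last by rewrite ler_pM2l.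
    by lra.
  rewrite addrAC; apply: (le_lt_trans (ler_normD _ _)); lra.
lra.
Qed.

(* The blend [(1 - l) h + l v] is performed in two successive steps, whose
   decreases add up; this replaces a partition of unity. *)
Lemma descends_glue (h : R -> V) (r0 c t0 : R) v r : continuous h -> (forall s, `|h s| <= 1) ->
  (forall s, s <= 0 -> h s = 0) -> 0 < r0 -> 0 < c -> t0 - r < c -> `|v| <= 1 ->
  0 < r -> descends h r0 (fun s => s <= c) -> local_descent t0 v r ->
  exists (h' : R -> V) (r' : R), [/\ continuous h', forall s, `|h' s| <= 1,
    forall s, s <= 0 -> h' s = 0, 0 < r' &
    descends h' r' (fun s => s < t0 + r) /\ forall s, c <= s -> h' s = v].
Proof.
move=> hc h1 h0 r00 c0 tc v1 rp hd ld.
(* The blend takes place on [b, c]. The maximum with 0 keeps the new field zero on the negative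
   side; [t0 - r] keeps the use of [v] inside its domain of validity. *)
pose b := Num.max 0 (t0 - r).
have bc : b < c by rewrite gt_max c0.
have cb0 : 0 < c - b by rewrite subr_gt0.
pose l s := clamp ((s - b) / (c - b)).
have l01 s : 0 <= l s <= 1 by exact: clamp_itv.
have lc : continuous l.
  move=> s.
  apply: (@continuous_comp _ _ _ (fun s => (s - b) / (c - b)) (@clamp R));
    last exact: clamp_continuous.
  apply: cvgM; last exact: cvg_cst.
  by apply: cvgB; [exact: cvg_id|exact: cvg_cst].
have l0 s : s <= b -> l s = 0.
  move=> sb; apply: clamp0; rewrite pmulr_lle0 ?invr_gt0//; lra.
have l1 s : c <= s -> l s = 1.
  by move=> cs; apply: clamp1; rewrite ler_pdivlMr// mul1r lerD2r.
exists (fun s => (1 - l s) *: h s + l s *: v), (Num.min r0 (r / 2)); split.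
- move=> s; apply: cvgD; apply: cvgZ.
  + by apply: cvgB; [exact: cvg_cst|exact: lc].
  + exact: hc.
  + exact: lc.
  + exact: cvg_cst.
- move=> s; have /andP[? ?] := l01 s.
  apply: (le_trans (ler_normD _ _)); rewrite !normrZ !ger0_norm ?subr_ge0//.
  have : (1 - l s) * `|h s| <= 1 - l s by rewrite ler_piMr// subr_ge0.
  have : l s * `|v| <= l s by rewrite ler_piMr.
  lra.
- move=> s s0; rewrite l0 ?h0// ?scale0r ?scaler0 ?addr0//.
  by rewrite le_max s0.
- by rewrite lt_min r00 divr_gt0.
split; last by move=> s cs; rewrite l1// subrr scale0r scale1r add0r.
move=> s t sr /andP[t_0]; rewrite le_min => /andP[tr0 tr].
have [sb|bs] := leP s b.
  rewrite l0// subr0 scale1r scale0r addr0; apply: hd; first exact: le_trans (ltW bc).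
  by rewrite t_0.
have /andP[ls0 ls1] := l01 s.
have -> : M - e * t = M - e * (t * (1 - l s) + t * l s).
  by rewrite -mulrDr subrK mulr1.
rewrite scalerDr !scalerA addrA.
have tl0 : 0 <= t * (1 - l s) by rewrite mulr_ge0// subr_ge0.
have tlt : t * (1 - l s) <= t by rewrite ler_piMr// lerBlDr lerDl.
apply: (ld s) => //.
- have : t0 - r < s by apply: le_lt_trans bs; rewrite le_max lexx orbT.
  by move=> ?; rewrite ltr_norml; apply/andP; split; lra.
- rewrite addrAC subrr add0r normrZ ger0_norm//.
  apply: (@le_lt_trans _ _ t); last lra.
  by apply: le_trans tlt; rewrite ler_piMr.
- by rewrite mulr_ge0.
- by rewrite -mulrDr subrK mulr1; lra.
(* Beyond [c] the old field gives no descent, but there [l s = 1]: the first step has length zero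
   and [F (g s) <= M] is enough. *)
have [sc|cs] := leP s c.
  by apply: hd => //; rewrite tl0 (le_trans tlt).
by rewrite l1 ?(ltW cs)// subrr mulr0 scale0r addr0 mulr0 subr0.
Qed.

Lemma local_descent_exists t0 :
  exists v r, [/\ `|v| <= 1, 0 < r & local_descent t0 v r].
Proof.
have [low|high] := ltP (F (g t0)) m; last exact: local_descent_high.
by have [r r0 rP] := local_descent_low low; exists 0, r; rewrite normr0 ler01.
Qed.

(* By a supremum argument, gluing carries a descent field from [0, c] past every
   point of [0, 1]. It vanishes near the ends, where F is below m. *)
Lemma path_descent : exists (g' : R -> V) (t : R), [/\ 0 < t, continuous g',
  forall s, s <= 0 -> g' s = g 0, forall s, 1 <= s -> g' s = g 1 &
  forall s, `|g' s - g s| <= t /\ F (g' s) <= M - e * t].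
Proof.
pose field (h : R -> V) (r : R) := [/\ continuous h, forall s, `|h s| <= 1,
    forall s, s <= 0 -> h s = 0 & 0 < r].
pose S := [set c : R | 0 < c <= 1 /\ exists (h : R -> V) (r : R), field h r /\
  descends h r (fun s => s <= c)].
have hS : has_ubound S by exists 1 => c [/andP[]].
have [b Sb] : S !=set0.
  have [r r0 rP] := local_descent_low Fg0.
  have r20 : 0 < r / 2 by rewrite divr_gt0.
  exists (Num.min 1 (r / 2)); split; first by rewrite lt_min ltr01 r20 ge_min lexx.
  exists (fun=> 0), (r / 2); split.
    by split=> //; [exact: cst_continuous|move=> s; rewrite normr0].
  move=> s t; rewrite le_min => /andP[_ sr] /andP[t_0 tr].
  have [s0|s0] := leP s 0.
    rewrite g0// -[t in e * t]add0r; apply: (rP 0) => //.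
    + by rewrite subrr normr0.
    + by rewrite subrr normr0.
    + lra.
    + by rewrite mulr0 subr0.
  rewrite -[t in e * t]add0r; apply: (rP s) => //.
  + by rewrite subr0 gtr0_norm//; lra.
  + by rewrite subrr normr0.
  + lra.
  + by rewrite mulr0 subr0.
have hsS : has_sup S by split=> //; exists b.
have t0le c : S c -> c <= sup S by move=> Sc; exact: ub_le_sup.
have adh d : 0 < d -> exists2 c, S c & sup S - d < c.
  by move=> d0; exact: sup_adherent.
have t01 : sup S <= 1 by apply: ge_sup => [|c [/andP[]]//]; exists b.
move: (sup S) t0le adh t01 => t0 t0le adh t01.
have t00 : 0 < t0 by have [/andP[b0 _] _] := Sb; exact: lt_le_trans b0 (t0le _ Sb).
(* If [t0 < 1], gluing a field valid up to some [c > t0 - r] with the local descent at [t0] reaches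
   beyond [t0]. *)
have t0E : t0 = 1.
  apply/eqP; rewrite eq_le t01/= leNgt; apply/negP => t0lt.
  have [v [r [v1 r0 ld]]] := local_descent_exists t0.
  have [c [/andP[c0 c1] [h [q [[hc h1 h0 q0] hd]]]] cr] := adh r r0.
  have [h' [q' [hc' h1' h0' q0' [hd' _]]]] :=
    descends_glue hc h1 h0 q0 c0 cr v1 r0 hd ld.
  have : Num.min 1 (t0 + r / 2) <= t0.
    apply: t0le; split.
      rewrite lt_min ltr01 ge_min lexx/= andbT; lra.
    exists h', q'; split=> // s t; rewrite le_min => /andP[_ sr].
    by apply: hd'; lra.
  by rewrite ge_min => /orP[|]; lra.
(* One last gluing with the zero vector makes the field vanish from [c] on, which fixes the end of
   the path. *)
have [r r0 ld] := local_descent_low Fg1.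
have [c [/andP[c0 c1] [h [q [[hc h1 h0 q0] hd]]]] cr] := adh r r0.
rewrite t0E in cr.
have v1 : `|0 : V| <= 1 by rewrite normr0.
have [h' [q' [hc' h1' h0' q0' [hd' hv]]]] :=
  descends_glue hc h1 h0 q0 c0 cr v1 r0 hd ld.
have hv1 s : 1 <= s -> h' s = 0 by move=> s1; apply: hv; exact: le_trans s1.
exists (fun s => g s + q' *: h' s), q'; split=> //.
- move=> s; apply: cvgD; first exact: gc.
  by apply: cvgZ; [exact: cvg_cst|exact: hc'].
- by move=> s s0; rewrite h0'// scaler0 addr0 g0.
- by move=> s s1; rewrite hv1// scaler0 addr0 g1.
move=> s; split.
  rewrite addrAC subrr add0r normrZ gtr0_norm//.
  by rewrite ler_piMr// ltW.
have qq : 0 <= q' <= q' by rewrite lexx ltW.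
have [s1|s1] := leP s 1; first by apply: hd' => //; lra.
rewrite g1 ?(ltW s1)// hv1 ?(ltW s1)// -(hv1 1)//.
by apply: hd' => //; lra.
Qed.

End path_descent.

(** * Mountain pass and uniqueness of the zero *)

(** If all slopes in the slab exceeded [e], [path_descent] would lower a path that the ordering
    principle made minimal. The bound [B], the maximum of [F] on the segment, is independent of [e],
    so letting [e] tend to 0 yields a Palais-Smale sequence. *)
Lemma mountain_pass (R : realType) (V : completeNormedModType R) (F : V -> R)
    (D : V -> V -> R) (x1 x2 : V) (m a : R) :
  (forall x k h, D x (k *: h) = k * D x h) ->
  (forall x, strict_diff F x (D x)) -> continuous F ->
  F x1 < m -> F x2 < m -> m < a ->
  (forall g : R -> V, continuous g -> g 0 = x1 -> g 1 = x2 ->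
    exists t, a <= F (g t)) ->
  exists B : R, forall e : R, 0 < e ->
    exists2 x, m <= F x <= B & forall h, `|D x h| <= e * `|h|.
Proof.
move=> DZ FD Fc Fx1 Fx2 ma cross.
(* Pairs (path, upper bound of F on it): working in the epigraph of the maximum
   of F along paths makes the ordering principle applicable without sup norms. *)
pose adm (q : (R -> V) * R) := [/\ continuous q.1,
  forall s, s <= 0 -> q.1 s = x1, forall s, 1 <= s -> q.1 s = x2 &
  forall s, F (q.1 s) <= q.2].
have adm_ge q : adm q -> a <= q.2.
  move=> [qc q0 q1 qF]; have [t Ft] := cross _ qc (q0 0 (lexx 0)) (q1 1 (lexx 1)).
  exact: le_trans Ft (qF t).
pose p (s : R) := x1 + clamp s *: (x2 - x1).
have pc : continuous p.
  move=> s; apply: cvgD; first exact: cvg_cst.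
  by apply: cvgZ; [exact: clamp_continuous|exact: cvg_cst].
have Fpc : continuous (F \o p).
  by move=> s; apply: continuous_comp; [exact: pc|exact: Fc].
have [c _ cP] := EVT_max (@ler01 R) (continuous_subspaceT Fpc).
pose B := F (p c).
have admp : adm (p, B).
  split=> //=.
  - by move=> s s0; rewrite /p clamp0// scale0r addr0.
  - by move=> s s1; rewrite /p clamp1// scale1r addrC subrK.
  move=> s; have -> : p s = p (clamp s).
    rewrite /p; congr (_ + _ *: _); have [s0|s0] := leP s 0.
      by rewrite (clamp0 s0) clamp0.
    have [s1|s1] := leP s 1; last by rewrite (clamp1 (ltW s1)) clamp1.
    have E : clamp s = s by rewrite /clamp min_r// max_r// ltW.
    by rewrite !E.
  by apply: cP; rewrite in_itv /=; exact: clamp_itv.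
exists B => e e0; apply: contrapT => noncrit.
have steep x : m <= F x -> F x <= B -> exists2 v, `|v| <= 1 & D x v < - e.
  move=> mx xB.
  have [h hP] : exists h, ~ (`|D x h| <= e * `|h|).
    apply: contrapT => H; apply: noncrit; exists x; first by rewrite mx.
    by move=> h; apply: contrapT => hP; apply: H; exists h.
  move/negP: hP; rewrite -ltNge => hP.
  have h0 : 0 < `|h|.
    rewrite normr_gt0; apply/eqP => h0; move: hP.
    by rewrite h0 -(scale0r (0 : V)) DZ mul0r scale0r !normr0 mulr0 ltxx.
  exists ((- Num.sg (D x h) / `|h|) *: h).
    rewrite normrZ normrM normrN normfV normr_id -mulrA mulVf ?gt_eqF// mulr1.
    by rewrite normr_sg lern1 leq_b1.
  by rewrite DZ mulrAC mulNr -normrEsg mulNr ltrN2 ltr_pdivlMr.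
pose T := {q | adm q}.
pose le (q r : T) := forall t, e * `|(sval q).1 t - (sval r).1 t|
  <= (sval r).2 - (sval q).2.
have mono q r : le q r -> (sval q).2 <= (sval r).2.
  move=> qr; rewrite -subr_ge0; apply: le_trans (qr 0).
  by rewrite mulr_ge0// ltW.
have [] := @brezis_browder R T le (fun q => (sval q).2) a _ _ mono _ _
  (exist _ _ admp).
- by move=> q t; rewrite !subrr normr0 mulr0.
- move=> q r s qr rs t.
  have : e * `|(sval q).1 t - (sval s).1 t| <=
    e * `|(sval q).1 t - (sval r).1 t| + e * `|(sval r).1 t - (sval s).1 t|.
    by rewrite -mulrDr ler_pM2l// ler_distD.
  have := qr t; have := rs t; lra.
- by move=> q; apply: adm_ge; exact: svalP.
(* A decreasing sequence of pairs converges pointwise in [t]. The error bound [M n - limn M] does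
   not involve [t], so the limit path is continuous. *)
- move=> u ule; pose M n := (sval (u n)).2 / e.
  have tel t := @cvg_of_telescope R V (fun n => (sval (u n)).1 t) M (a / e).
  have uM t n : `|(sval (u n.+1)).1 t - (sval (u n)).1 t| <= M n - M n.+1.
    by rewrite -mulrBl ler_pdivlMr// mulrC; exact: ule.
  have aM n : a / e <= M n.
    by rewrite ler_pM2r ?invr_gt0//; apply: adm_ge; exact: svalP.
  have Mc : cvg (M n @[n --> \oo]) := (tel 0 (uM 0) aM).1.
  have /choice[l lP] : forall t, exists y, (sval (u n)).1 t @[n --> \oo] --> y /\
      forall n, `|y - (sval (u n)).1 t| <= M n - limn M.
    by move=> t; have [_ [y]] := tel t (uM t) aM; exists y.
  have near_u (d : R) : 0 < d -> exists n, M n - limn M < d.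
    move=> d0; have [n nP] := cvg_dist_near Mc d0.
    by exists n; apply: ltr_normlW; exact: nP.
  have ladm : adm (l, e * limn M).
    split=> /=.
    + move=> t; apply/continuous_distP => d d0.
      have d30 : 0 < d / 3 by rewrite divr_gt0.
      have [n nP] := near_u _ d30.
      have [unc _ _ _] := svalP (u n).
      have [r r0 rP] := (continuous_distP _ t).1 (unc t) _ d30.
      exists r => // s /rP sr.
      have ls := (lP s).2 n; have lt := (lP t).2 n; rewrite distrC in lt.
      rewrite -(subrKA ((sval (u n)).1 s)); apply: (le_lt_trans (ler_normD _ _)).
      have := ler_distD ((sval (u n)).1 t) ((sval (u n)).1 s) (l t); lra.
    + move=> s s0; apply/eqP; rewrite -subr_eq0 -normr_le0.
      apply/ler_addgt0Pr => d d0; rewrite add0r; have [n nP] := near_u _ d0.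
      have [_ + _ _] := svalP (u n) => /(_ s s0) <-.
      by apply: le_trans ((lP s).2 n) _; exact: ltW.
    + move=> s s0; apply/eqP; rewrite -subr_eq0 -normr_le0.
      apply/ler_addgt0Pr => d d0; rewrite add0r; have [n nP] := near_u _ d0.
      have [_ _ + _] := svalP (u n) => /(_ s s0) <-.
      by apply: le_trans ((lP s).2 n) _; exact: ltW.
    + move=> s.
      have Fl : F ((sval (u n)).1 s) @[n --> \oo] --> F (l s).
        by apply: cvg_comp (lP s).1 _; exact: Fc.
      have eM : e * M n @[n --> \oo] --> e * limn M.
        by apply: cvgM => //; exact: cvg_cst.
      apply: ler_cvg_to Fl eM _; near=> n.
      have [_ _ _ /(_ s)] := svalP (u n).
      by rewrite /M mulrCA divff ?gt_eqF// mulr1.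
  exists (exist _ _ ladm) => n t /=.
  rewrite -ler_pdivlMl// mulrBr mulKf ?gt_eqF// mulrC.
  exact: (lP t).2.
move=> [[g M] gadm] gp gmin.
have [/= gc g0 g1 gM] := gadm.
have MB : M <= B := mono _ _ gp.
have g0E := g0 0 (lexx 0); have g1E := g1 1 (lexx 1).
have [||||||||g' [t [t0 gc' g0' g1' gg']]] :=
  @path_descent R V F D DZ FD Fc g M a m e e0 gc.
- by move=> s s0; rewrite g0E g0.
- by move=> s s1; rewrite g1E g1.
- exact: gM.
- exact: ma.
- exact: (adm_ge _ gadm).
- by rewrite g0E.
- by rewrite g1E.
- by move=> x mx xM; apply: steep => //; exact: le_trans xM MB.
(* The deformed path moves by at most [t] while its ceiling drops by [e * t], so the new pair is
   below the minimal one with a strictly smaller second component. *)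
have g'adm : adm (g', M - e * t).
  split=> //=.
  - by move=> s s0; rewrite g0'.
  - by move=> s s1; rewrite g1'.
  - by move=> s; have [] := gg' s.
have : le (exist _ _ g'adm) (exist _ _ gadm).
  by move=> s /=; rewrite subKr ler_pM2l//; have [] := gg' s.
by move=> /gmin /=; have := mulr_gt0 e0 t0; lra.
Unshelve. all: by end_near. Qed.

(** The sphere of radius [q] around [x1] contains no zero and separates [x1] from [x2], so every
    path meets a level of at least [a]. The mountain pass sequence at levels above [a / 2] would
    cluster at a zero, against continuity of [F]. *)
Lemma unique_zero (R : realType) (V : completeNormedModType R) (F : V -> R)
    (D : V -> V -> R) : zero_critical F D ->
  (forall x, F x = 0 -> exists2 r, 0 < r &
    forall z, `|z - x| < r -> F z = 0 -> z = x) ->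
  forall x1 x2, F x1 = 0 -> F x2 = 0 -> x1 = x2.
Proof.
move=> FD isol x1 x2 F1 F2; apply/eqP; apply: contraT => x12.
have d0 : 0 < `|x2 - x1| by rewrite normr_gt0 subr_eq0 eq_sym.
have [r r0 rP] := isol _ F1.
pose q := Num.min r `|x2 - x1| / 2.
have q0 : 0 < q by rewrite divr_gt0// lt_min r0.
have qr : q < r.
  by rewrite ltr_pdivrMr// gt_min; apply/orP; left; lra.
have qd : q < `|x2 - x1|.
  by rewrite ltr_pdivrMr// gt_min; apply/orP; right; lra.
have distc : continuous (fun x => `|x - x1|).
  move=> x; apply: cvg_norm; apply: cvgB; [exact: cvg_id|exact: cvg_cst].
have [a a0 aF] : exists2 a : R, 0 < a & forall x, `|x - x1| = q -> a <= F x.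
  apply: (away_from_zeros (A := [set x | `|x - x1| = q]) FD).
    apply: (@preimage_closed _ _ (fun x => `|x - x1|) [set q]); last exact: closed_eq.
    by move=> x _; exact: distc.
  move=> x /= xq; apply/eqP => Fx.
  have : x = x1 by apply: rP => //; rewrite xq.
  by move=> xx1; move: xq q0; rewrite xx1 subrr normr0 => <-; rewrite ltxx.
have a20 : 0 < a / 2 by rewrite divr_gt0.
have [||||B BP] := @mountain_pass R V F D x1 x2 (a / 2) a (zc_scale FD)
  (zc_diff FD) (zc_continuous FD).
- by rewrite F1.
- by rewrite F2.
- by lra.
- move=> g gc g0 g1.
  have gd : continuous (fun t => `|g t - x1|).
    by move=> t; apply: cvg_norm; apply: cvgB; [exact: gc|exact: cvg_cst].
  have [t _ tq] : exists2 t, t \in `[0, 1] & `|g t - x1| = q.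
    apply: IVT => //; first exact: continuous_subspaceT.
    rewrite g0 g1 subrr normr0 ge_min le_max (ltW q0)/= (ltW qd) orbT.
    done.
  by exists t; exact: aF.
have /choice[u uP] : forall n : nat, exists x : V, a / 2 <= F x <= B /\
    forall h, `|D x h| <= n.+1%:R^-1 * `|h|.
  move=> n; have n0 : 0 < n.+1%:R^-1 :> R by rewrite invr_gt0.
  by have [x x1' x2'] := BP _ n0; exists x.
have [|l [Fl lu]] := ps_zero FD (u := u) (B := B) _ (fun n => (uP n).2).
  by move=> n; have [/andP[]] := uP n.
have [d dd0 dP] := (continuous_distP F l).1 (zc_continuous FD (x := l)) _ a20.
have [n _ /dP] := lu d 0%N dd0.
have [/andP[au _] _] := uP n.
by rewrite Fl subr0 => /ltr_normlW; rewrite ltNge au.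
Qed.

(** * Chain rule and inverse function estimates *)

(** Tolerance 1 makes [f] Lipschitz with constant [C + 1] near [x]. The error is that of [g] between
    [f a] and [f b], plus the image under [K] of the error of [f]; each gets [e / 2]. *)
Lemma strict_diff_comp (R : realType) (U V W : normedModType R) (f : U -> V)
    (g : V -> W) (x : U) (L : {linear U -> V}) (K : {linear V -> W}) :
  continuous L -> continuous K -> strict_diff f x L -> strict_diff g (f x) K ->
  strict_diff (g \o f) x (K \o L).
Proof.
move=> Lc Kc fL gK e e0.
have [C C0 LC] := linear_bound Lc; have [C' C'0 KC] := linear_bound Kc.
have C10 : 0 < C + 1 by rewrite addr_gt0.
have e20 : 0 < e / 2 by rewrite divr_gt0.
have [d1 d10 d1P] := fL 1 ltr01.
have [d2 d20 d2P] := fL _ (divr_gt0 e20 C'0).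
have [d3 d30 d3P] := gK _ (divr_gt0 e20 C10).
have fC a b : `|a - x| < d1 -> `|b - x| < d1 -> `|f b - f a| <= (C + 1) * `|b - a|.
  move=> ad bd; rewrite -(subrK (L (b - a)) (f b - f a)).
  apply: (le_trans (ler_normD _ _)); have := d1P a b ad bd; have := LC (b - a); lra.
exists (Num.min d1 (Num.min d2 (d3 / (C + 1)))).
  by rewrite !lt_min d10 d20 divr_gt0.
move=> a b; rewrite !lt_min => /and3P[a1 a2 a3] /and3P[b1 b2 b3].
have fd z : `|z - x| < d1 -> `|z - x| < d3 / (C + 1) -> `|f z - f x| < d3.
  move=> z1 z3; apply: (le_lt_trans (fC x z _ z1)); first by rewrite subrr normr0.
  by rewrite mulrC -ltr_pdivlMr.
have H1 := d3P (f a) (f b) (fd a a1 a3) (fd b b1 b3).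
have H2 := fC a b a1 b1.
have H3 := d2P a b a2 b2.
have H4 := KC (f b - f a - L (b - a)).
have {}H4 : `|K (f b - f a - L (b - a))| <= e / 2 * `|b - a|.
  apply: (le_trans H4); rewrite -ler_pdivlMl//; apply: (le_trans H3).
  by rewrite mulrA [C'^-1 * _]mulrC.
have {}H1 : `|g (f b) - g (f a) - K (f b - f a)| <= e / 2 * `|b - a|.
  apply: (le_trans H1); rewrite -ler_pdivlMl ?divr_gt0//.
  by rewrite mulrA invf_div divfK ?gt_eqF.
rewrite /= -(subrKA (K (f b - f a))); apply: (le_trans (ler_normD _ _)).
by rewrite -linearB [X in X * _]splitr mulrDl lerD.
Qed.

Lemma differentiable_of_dist (R : realType) (V W : normedModType R) (g : V -> W)
    (x : V) (L : {linear V -> W}) : continuous L ->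
  (forall e : R, 0 < e -> exists2 d : R, 0 < d & forall z : V,
    `|z - x| < d -> `|g z - g x - L (z - x)| <= e * `|z - x|) ->
  differentiable g x /\ 'd g x = L :> (V -> W).
Proof.
move=> Lc /differentiable_distP gL; have dL := diff_unique Lc gL.
by split=> //; apply/diff_locallyP; rewrite dL.
Qed.

Lemma strict_diff_differentiable (R : realType) (V W : normedModType R)
    (g : V -> W) (x : V) (L : {linear V -> W}) : continuous L ->
  strict_diff g x L -> differentiable g x /\ 'd g x = L :> (V -> W).
Proof.
move=> Lc gL; apply: differentiable_of_dist => // e e0.
have [d d0 dP] := gL e e0; exists d => // z; apply: dP.
by rewrite subrr normr0.
Qed.

Lemma Isom_inverse (R : realType) (V W : normedModType R) (L : {linear V -> W}) :
  Isom L -> exists2 K : {linear W -> V}, continuous K & cancel K L.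
Proof.
move=> [_ /choice[K KL] [a a0 aL]].
have Linj u v : L u = L v -> u = v.
  move=> uv; apply/eqP; rewrite -subr_eq0 -normr_le0 -(pmulr_rle0 _ a0).
  by apply: (le_trans (aL _)); rewrite linearB uv subrr normr0.
have Klin : linear K.
  by move=> k u v; apply: Linj; rewrite linearP !KL.
pose HK := GRing.isLinear.Build _ _ _ _ K Klin.
pose K' : {linear W -> V} := HB.pack K HK.
exists K' => //; apply/linear_bounded_continuous/linear_boundedP.
exists a^-1; split; first exact: num_real.
move=> r ar h; rewrite -(ler_pM2l a0); apply: (le_trans (aL _)).
rewrite [L _]KL mulrA ler_peMl// -ler_pdivrMl// mulr1; exact: ltW.
Qed.

(* Applied with [L k0 = w] and [L' k = w], where [L] is bounded below by [a],
   [L'] is close to [L], and [N] is the norm of [w]. *)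
Lemma perturbed_solution (R : realType) (V : normedModType R) (a e N : R)
    (k k0 : V) : 0 < a -> 0 < e -> a * `|k0| <= N ->
  a * `|k - k0| <= Num.min (a / 2) (e * (a * a / 2)) * `|k| ->
  `|k - k0| <= e * N.
Proof.
move=> a0 e0 k0N; set m := Num.min _ _ => H.
(* The bound [a / 2] absorbs the part of [k] that comes from [k - k0]; the other bound leaves
   [e * (a * |k0|)] after division by [a / 2]. *)
have ma : m <= a / 2 by rewrite ge_min lexx.
have me : m <= e * (a * a / 2) by rewrite ge_min lexx orbT.
have a20 : 0 < a / 2 by rewrite divr_gt0.
have m0 : 0 <= m by rewrite le_min !ltW// !(mulr_gt0, divr_gt0).
have tri : m * `|k| <= m * `|k - k0| + m * `|k0|.
  by rewrite -mulrDr ler_wpM2l// -[k in leLHS](subrK k0) ler_normD.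
have H1 : m * `|k - k0| <= a / 2 * `|k - k0| by rewrite ler_wpM2r.
have H2 : m * `|k0| <= e * (a * a / 2) * `|k0| by rewrite ler_wpM2r.
apply: (@le_trans _ _ (e * (a * `|k0|))); last by rewrite ler_pM2l.
by rewrite -(ler_pM2l a20); lra.
Qed.

(** Two uses of [perturbed_solution]: [k = g z - g y] against [k0 = K (z - y)] for
    differentiability, then [k = 'd g z h] against [k0 = 'd g y h] for continuity of the
    derivative. *)
Lemma C1_inverse (R : realType) (V W : normedModType R) (f : V -> W)
    (g : W -> V) : C1 f -> (forall x, Isom ('d f x)) -> cancel g f ->
  continuous g -> C1 g.
Proof.
move=> fC1 fI gf gc.
have near_g y (d : R) : 0 < d ->
    exists2 d', 0 < d' & forall z, `|z - y| < d' -> `|g z - g y| < d.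
  by move=> d0; exact: (continuous_distP g y).1 (gc y) _ d0.
have gdiff y : differentiable g y /\ forall h, 'd f (g y) ('d g y h) = h.
  have [K Kc KL] := Isom_inverse (fI (g y)).
  have [_ _ [a a0 aL]] := fI (g y).
  have [] := @differentiable_of_dist R W V g y K Kc; last by move=> ? ->.
  move=> e e0; have m0 : 0 < Num.min (a / 2) (e * (a * a / 2)).
    by rewrite lt_min !(mulr_gt0, divr_gt0).
  have [d d0 dP] := C1_strict_diff (g y) fC1 m0.
  have [d' d'0 d'P] := near_g y d d0; exists d' => // z /d'P zd.
  have := dP (g y) (g z); rewrite subrr normr0 => /(_ d0 zd) H.
  apply: (perturbed_solution a0 e0).
    by apply: (le_trans (aL _)); rewrite KL.
  apply: (le_trans (aL _)); rewrite linearB KL.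
  by rewrite !gf distrC in H.
split=> [y|y]; first exact: (gdiff y).1.
apply/cvg_opnorm0P.
  by move=> z k h /=; rewrite !linearZ; exact/esym/scalerDr.
move=> e e0; have [_ _ [a a0 aL]] := fI (g y).
have m0 : 0 < Num.min (a / 2) (e * (a * a / 2)).
  by rewrite lt_min !(mulr_gt0, divr_gt0).
have [d d0 dP] := C1_dist (g y) fC1 m0.
have [d' d'0 d'P] := near_g y d d0.
apply/nbhs_distP; exists d' => // z /d'P/dP zd h /=.
apply: (perturbed_solution a0 e0).
  by apply: (le_trans (aL _)); rewrite (gdiff y).2.
apply: (le_trans (aL _)); rewrite linearB (gdiff y).2.
by have := zd ('d g z h); rewrite (gdiff z).2 distrC.
Qed.

(** With tolerance [a / 2], equal values would give [a * |z - x| <= a / 2 * |z - x|]. *)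
Lemma Isom_locally_injective (R : realType) (V W : normedModType R) (f : V -> W)
    (x : V) : C1 f -> Isom ('d f x) ->
  exists2 r : R, 0 < r & forall z, `|z - x| < r -> f z = f x -> z = x.
Proof.
move=> fC1 [_ _ [a a0 aL]].
have a20 : 0 < a / 2 by rewrite divr_gt0.
have [r r0 rP] := C1_strict_diff x fC1 a20; exists r => // z zx fzx.
have := rP x z; rewrite subrr normr0 fzx subrr sub0r normrN => /(_ r0 zx) H.
apply/eqP; rewrite -subr_eq0 -normr_le0 -(pmulr_rle0 _ a20).
have := aL (z - x); lra.
Qed.

Lemma composite_zero_critical (R : realType) (X Y : completeNormedModType R)
    (f : X -> Y) (eta : Y -> R) (y : Y) : C1 f -> C1 eta ->
  (forall z, 0 <= eta z) -> eta 0 = 0 ->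
  (forall z, 'd eta z = cst 0 :> (Y -> R) -> z = 0) ->
  palais_smale (fun x => eta (f x - y)) -> (forall x, Isom ('d f x)) ->
  zero_critical (fun x => eta (f x - y)) (fun x => 'd eta (f x - y) \o 'd f x).
Proof.
move=> fC1 etaC1 eta0 etaz detaz PS fI.
have fc x : continuous ('d f x) by apply: diff_continuous; exact: fC1.1.
have etac z : continuous ('d eta z) by apply: diff_continuous; exact: etaC1.1.
have sd x : strict_diff (fun x => eta (f x - y)) x ('d eta (f x - y) \o 'd f x).
  apply: (@strict_diff_comp _ _ _ _ (fun x => f x - y) eta) => //.
    move=> e e0; have [d d0 dP] := C1_strict_diff x fC1 e0.
    exists d => // a b ad bd.
    by rewrite opprB subrKA; exact: dP.
  exact: C1_strict_diff.
have dc x : continuous ('d eta (f x - y) \o 'd f x).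
  by move=> h; apply: continuous_comp; [exact: fc|exact: etac].
split=> //.
- by move=> x k h /=; rewrite !linearZ_LR.
- by move=> x; have [C _ CP] := linear_bound (dc x); exists C.
- move=> u B uB uD; have [_ PS'] := PS.
  (* Identifying the Gâteaux derivative with the chain rule expression makes the Palais-Smale
     hypothesis applicable. *)
  have dE x : gateaux_derivative (fun x => eta (f x - y)) x =
      'd eta (f x - y) \o 'd f x.
    have [dx dxE] := strict_diff_differentiable (dc x) (sd x).
    by apply/funext => h; rewrite /gateaux_derivative deriveE// dxE.
  have [||k kinc /cvg_ex[l kl]] := PS' u.
  + exists B; split; first exact: num_real.
    move=> M BM n _ /=; rewrite ger0_norm//; apply: le_trans (ltW BM).
    exact: uB.
  + apply/cvg_opnorm0P.
      by move=> n c h; rewrite dE /= !linearZ_LR.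
    move=> e e0; have [N NP] := invSn_lt e0; exists N => // n /= Nn h.
    rewrite dE; apply: (le_trans (uD n h)).
    by rewrite ler_wpM2r// ltW// NP.
  exists k, l; split=> // n; elim: n => // n IH.
  by apply: (leq_ltn_trans IH); exact: kinc.
(* Since ['d f x] is onto, a vanishing composite forces ['d eta (f x - y)] to vanish. *)
- move=> x dx; suff -> : f x - y = 0 by [].
  apply: detaz; apply/funext => w.
  have [_ /(_ w)[h <-] _] := fI x; exact: dx.
Qed.

(** * Bijectivity and regularity of the inverse *)

Theorem theorem3p6 (R : realType) (X Y : completeNormedModType R)
    (f : X -> Y) (eta : Y -> R)
    (f_C1 : C1 f)
    (eta_ge0 : forall y : Y, 0 <= eta y)
    (eta_C1 : C1 eta)
    (eta_eq0 : forall y : Y, eta y = 0 <-> y = 0)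
    (deta_eq0 : forall y : Y, 'd eta y = cst 0 :> (Y -> R) <-> y = 0)
    (PS : forall y : Y, palais_smale (fun x : X => eta (f x - y)))
    (df_isom : forall x : X, Isom ('d f x)) :
  diffeomorphism f.
Proof.
have eta00 : eta 0 = 0 by exact/eta_eq0.
have FD y := composite_zero_critical f_C1 eta_C1 eta_ge0 eta00
  (fun z => (deta_eq0 z).1) (PS y) df_isom.
have zeroE x y : eta (f x - y) = 0 <-> f x = y.
  by split=> [/eta_eq0/subr0_eq|->]; rewrite ?subrr.
have /choice[g fg] : forall y, exists x, f x = y.
  by move=> y; have [x /zeroE] := exists_zero (FD y); exists x.
have finj x1 x2 : f x1 = f x2 -> x1 = x2.
  move=> f12; apply: (unique_zero (FD (f x2))); try exact/zeroE.
  move=> x /zeroE fx; have [r r0 rP] := Isom_locally_injective f_C1 (df_isom x).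
  by exists r => // z zx /zeroE fz; apply: rP => //; rewrite fz.
split=> //; exists g; split=> //; first by move=> x; apply: finj; rewrite fg.
apply: (C1_inverse f_C1 df_isom fg) => y.
apply/continuous_distP => r r0.
have distc : continuous (fun x => `|x - g y|).
  by move=> x; apply: cvg_norm; apply: cvgB; [exact: cvg_id|exact: cvg_cst].
(* Off the ball of radius [r] around [g y] the functional for [y] is at least [a], whereas at [g z]
   it equals [eta (z - y)], which is small for [z] near [y]. *)
have [||a a0 aP] := away_from_zeros (A := [set x | r <= `|x - g y|]) (FD y).
- apply: (@preimage_closed _ _ (fun x => `|x - g y|) [set t | r <= t]);
    last exact: closed_ge.
  by move=> x _; exact: distc.
- move=> x /= rx; apply/eqP => /zeroE fx; move: rx.
  by rewrite -fx (finj (g (f x)) x (fg _)) subrr normr0 leNgt r0.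
have eta_cont : {for 0, continuous eta}.
  exact/differentiable_continuous/eta_C1.1.
have [d d0 dP] := (continuous_distP eta 0).1 eta_cont _ a0.
exists d => // z zy; rewrite ltNge; apply/negP => /aP.
rewrite fg; have := dP (z - y); rewrite subr0 eta00 subr0 => /(_ zy).
by move=> /ltr_normlW; rewrite ltNge => /negP.
Qed.
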